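(* Let $\mathfrak C$ be a left cancellative small category. The following are equivalent: (i) $I_l\ltimes\Omega$ is topologically free; (ii) $\mathfrak C^{*,0}\ltimes\Omega$ is topologically free; (iii) For all $\mathfrak v\in\mathfrak C^0$, $u\in\mathfrak v\mathfrak C^*\mathfrak v$ and $f_1,\dots,f_n\in\mathcal J$ with $f_i\subsetneq\mathfrak v\mathfrak C$ for all $1\le i\le n$: if $uz\in z\mathfrak C^*$ for all $z\in\mathfrak v\mathfrak C\setminus\bigcup_{i=1}^nf_i$, then there exists $x\in\mathfrak v\mathfrak C\setminus\bigcup_{i=1}^nf_i$ with $ux=x$.
   Context: $\mathfrak C$ denotes the set of morphisms, $\mathfrak C^0\subseteq\mathfrak C$ the identity morphisms (identified with objects), $\mathfrak d,\mathfrak t$ domain and target; $cd$ is defined iff $\mathfrak d(c)=\mathfrak t(d)$; left cancellative means $cx=cy\Rightarrow x=y$. For $S\subseteq\mathfrak C$, $cS=\{cs:s\in S,\mathfrak t(s)=\mathfrak d(c)\}$. $\mathfrak C^*$ is the set of invertible elements, $\mathfrak v\mathfrak C^*\mathfrak v$ the set of $u\in\mathfrak C^*$ with $\mathfrak t(u)=\mathfrak d(u)=\mathfrak v$, and $\mathfrak C^{*,0}=\{u\in\mathfrak C^*:\mathfrak t(u)=\mathfrak d(u)\}$. Each $c\in\mathfrak C$ gives the partial bijection $\mathfrak d(c)\mathfrak C\to c\mathfrak C$, $x\mapsto cx$, again denoted $c$; $I_l$ is the smallest semigroup of partial bijections of $\mathfrak C$ containing these and closed under inverses; $\mathcal J=\{\mathrm{dom}(s):s\in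 I_l\}$ is its semilattice of idempotents (product = intersection, order = inclusion). $\widehat{\mathcal J}$ is the space of non-zero multiplicative maps $\chi:\mathcal J\to\{0,1\}$ with $\chi(\emptyset)=0$ if $\emptyset\in\mathcal J$ (pointwise convergence). $\Omega\subseteq\widehat{\mathcal J}$ consists of those $\chi$ such that whenever $e=\bigcup_{i=1}^nf_i$ ($e,f_i\in\mathcal J$) and $\chi(e)=1$, then $\chi(f_i)=1$ for some $i$. $s\in I_l$ acts by $\chi\mapsto s.\chi=\chi(s^{-1}\cdot s)$ from $\Omega(s^{-1}s)=\{\chi\in\Omega:\chi(s^{-1}s)=1\}$ onto $\Omega(ss^{-1})$. $I_l\ltimes\Omega$ is the transformation groupoid: classes $[s,\chi]$ with $s\in I_l$, $\chi\in\Omega(s^{-1}s)$, where $[s,\chi]=[t,\psi]$ iff $\chi=\psi$ and $se=te$ for some $e\in\mathcal J$ with $\chi(e)=1$; source $\chi$, range $s.\chi$, $[s,t.\chi][t,\chi]=[st,\chi]$; topology such that the sets $\{[s,\chi]:\chi\in\Omega(s^{-1}s)\}$ are open and the source map restricts to homeomorphisms from them onto $\Omega(s^{-1}s)$. $\mathfrak C^{*,0}\ltimes\Omega:=\{[u,\chi]\in I_l\ltimes\Omega:u\in\mathfrak C^{*,0}\}$, an open subgroupoid. An étale groupoid $\mathcal G$ (not necessarily Hausdorff) is topologically free if for every open bisection $\gamma\subseteq\mathcal G\setminus\mathcal G^{(0)}$, the set $\{x\in\mathcal G^{(0)}:\mathcal G^x_x\cap\gamma\ne\emptyset\}$ has empty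 interior. *)

(* Defs.v *)
From HB Require Import structures.
From mathcomp Require Import all_boot all_classical.
From mathcomp Require Import topology.

Set Implicit Arguments.
Unset Strict Implicit.
Unset Printing Implicit Defensive.

Local Open Scope classical_set_scope.

Lemma within_pairP (X Y Z : topologicalType) (A : set (X * Y))
    (f : X * Y -> Z) :
  {within A, continuous f} <->
  forall x y, A (x, y) -> forall W, open W -> W (f (x, y)) ->
    exists U V, [/\ open U, U x, open V, V y &
      forall x' y', U x' -> V y' -> A (x', y') -> W (f (x', y'))].
Proof.
rewrite continuous_subspace_in.
split=> [cf x y Axy W oW Wf|cf [x y] /set_mem Axy W].
  have /(cf (x, y) (mem_set Axy)) : nbhs (f (x, y)) W by exact: open_nbhs_nbhs.
  rewrite /nbhs /= -nbhs_subspace_in // => -[[U V] [/= nU nV] UV].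
  exists U°, V°; split; try exact: open_interior.
  - exact: nU.
  - exact: nV.
  - move=> x' y' /interior_subset Ux /interior_subset Vy Axy'.
    exact: UV (x', y') (conj Ux Vy) Axy'.
rewrite nbhsE => -[W' [oW' W'f] W'W].
have [U [V [oU Ux oV Vy UV]]] := cf x y Axy W' oW' W'f.
rewrite /nbhs /= -nbhs_subspace_in //.
exists (U, V); first by split; exact: open_nbhs_nbhs.
by move=> [x' y'] [/= Ux' Vy'] Axy'; apply: W'W; exact: UV.
Qed.

(** * Étale groupoids *)

Definition local_homeo (X Y : topologicalType) (f : X -> Y) : Prop :=
  forall x, exists U : set X,
    [/\ open U, U x, set_inj U f, {within U, continuous f} &
        forall V, open V -> V `<=` U -> open (f @` V)].

(* The unit space is a separate type [gunits], embedded in the arrows by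
   [gunit]; this embedding is a homeomorphism onto its image, since [gsrc] is a
   continuous left inverse.  The product [gmul g h] is only meaningful when
   [gsrc g = grng h].  No separation property is required. *)
Record etale_groupoid := EtaleGroupoid {
  garr :> topologicalType;
  gunits : topologicalType;
  gunit : gunits -> garr;
  gsrc : garr -> gunits;
  grng : garr -> gunits;
  gmul : garr -> garr -> garr;
  ginv : garr -> garr;
  gsrc_unit : forall x, gsrc (gunit x) = x;
  grng_unit : forall x, grng (gunit x) = x;
  gsrc_mul : forall g h, gsrc g = grng h -> gsrc (gmul g h) = gsrc h;
  grng_mul : forall g h, gsrc g = grng h -> grng (gmul g h) = grng g;
  gmulA : forall g h k, gsrc g = grng h -> gsrc h = grng k ->
    gmul g (gmul h k) = gmul (gmul g h) k;
  gmul1 : forall g, gmul g (gunit (gsrc g)) = g;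
  g1mul : forall g, gmul (gunit (grng g)) g = g;
  gsrc_inv : forall g, gsrc (ginv g) = grng g;
  grng_inv : forall g, grng (ginv g) = gsrc g;
  gmulV : forall g, gmul g (ginv g) = gunit (grng g);
  gVmul : forall g, gmul (ginv g) g = gunit (gsrc g);
  gunit_continuous : continuous gunit;
  gsrc_continuous : continuous gsrc;
  grng_continuous : continuous grng;
  gmul_continuous :
    {within [set p : garr * garr | gsrc p.1 = grng p.2],
      continuous (fun p => gmul p.1 p.2)};
  ginv_continuous : continuous ginv;
  gsrc_local_homeo : local_homeo gsrc
}.

Section TopologicallyFree.
Variable G : etale_groupoid.

(* As source and range are local homeomorphisms, they restrict to
   homeomorphisms from an open bisection onto open sets of units. *)
Definition open_bisection (gamma : set G) : Prop :=
  [/\ open gamma, set_inj gamma (@gsrc G) & set_inj gamma (@grng G)].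

Definition isotropy (x : gunits G) : set G :=
  [set g | gsrc g = x /\ grng g = x].

Definition topologically_free : Prop :=
  forall gamma : set G, open_bisection gamma ->
    gamma `<=` ~` range (@gunit G) ->
    [set x | isotropy x `&` gamma !=set0]° = set0.

End TopologicallyFree.

(** The open subgroupoid of arrows in an open set [H] containing all units *)

Section OpenSubgroupoid.
Variables (G : etale_groupoid) (H : set G).
Hypothesis H_open : open H.
Hypothesis H_unit : forall x, H (gunit x).
Hypothesis H_mul : forall g h, gsrc g = grng h -> H g -> H h -> H (gmul g h).
Hypothesis H_inv : forall g, H g -> H (ginv g).

Definition sub_arr (g : G) (Hg : H g) : H := exist _ g (mem_set Hg).

Lemma sub_arrP (g : H) : H (val g).
Proof. exact: set_mem (valP g). Qed.

Definition sub_unit x : H := sub_arr (H_unit x).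
Definition sub_src (g : H) := gsrc (val g).
Definition sub_rng (g : H) := grng (val g).
Definition sub_inv (g : H) : H := sub_arr (H_inv (sub_arrP g)).
Definition sub_mul (g h : H) : H :=
  if pselect (sub_src g = sub_rng h) is left E
  then sub_arr (H_mul E (sub_arrP g) (sub_arrP h)) else g.

Lemma sub_mulE g h : sub_src g = sub_rng h ->
  val (sub_mul g h) = gmul (val g) (val h).
Proof. by rewrite /sub_mul; case: pselect. Qed.

Lemma sub_val_continuous : continuous (val : H -> G).
Proof. exact: initial_continuous. Qed.

Lemma sub_continuous (X : topologicalType) (f : X -> H) :
  continuous (val \o f) -> continuous f.
Proof.
move=> /continuousP cf; apply/continuousP => _ [V oV <-].
by rewrite -comp_preimage; exact: cf.
Qed.

Lemma sub_src_unit x : sub_src (sub_unit x) = x.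
Proof. exact: gsrc_unit. Qed.

Lemma sub_rng_unit x : sub_rng (sub_unit x) = x.
Proof. exact: grng_unit. Qed.

Lemma sub_src_mul g h : sub_src g = sub_rng h ->
  sub_src (sub_mul g h) = sub_src h.
Proof. by move=> E; rewrite /sub_src sub_mulE // gsrc_mul. Qed.

Lemma sub_rng_mul g h : sub_src g = sub_rng h ->
  sub_rng (sub_mul g h) = sub_rng g.
Proof. by move=> E; rewrite /sub_rng sub_mulE // grng_mul. Qed.

Lemma sub_mulA g h k : sub_src g = sub_rng h -> sub_src h = sub_rng k ->
  sub_mul g (sub_mul h k) = sub_mul (sub_mul g h) k.
Proof.
move=> E F; apply: val_inj.
by rewrite !sub_mulE ?sub_src_mul ?sub_rng_mul // gmulA.
Qed.

Lemma sub_mul1 g : sub_mul g (sub_unit (sub_src g)) = g.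
Proof.
by apply: val_inj; rewrite sub_mulE ?sub_rng_unit //; exact: gmul1.
Qed.

Lemma sub_1mul g : sub_mul (sub_unit (sub_rng g)) g = g.
Proof.
by apply: val_inj; rewrite sub_mulE ?sub_src_unit //; exact: g1mul.
Qed.

Lemma sub_src_inv g : sub_src (sub_inv g) = sub_rng g.
Proof. exact: gsrc_inv. Qed.

Lemma sub_rng_inv g : sub_rng (sub_inv g) = sub_src g.
Proof. exact: grng_inv. Qed.

Lemma sub_mulV g : sub_mul g (sub_inv g) = sub_unit (sub_rng g).
Proof.
by apply: val_inj; rewrite sub_mulE ?sub_rng_inv //; exact: gmulV.
Qed.

Lemma sub_Vmul g : sub_mul (sub_inv g) g = sub_unit (sub_src g).
Proof.
by apply: val_inj; rewrite sub_mulE ?sub_src_inv //; exact: gVmul.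
Qed.

Lemma sub_unit_continuous : continuous sub_unit.
Proof. by apply: sub_continuous; exact: gunit_continuous. Qed.

Lemma sub_src_continuous : continuous sub_src.
Proof.
move=> g; exact: (@continuous_comp _ _ _ _ _ g
  (@sub_val_continuous g) (@gsrc_continuous G (val g))).
Qed.

Lemma sub_rng_continuous : continuous sub_rng.
Proof.
move=> g; exact: (@continuous_comp _ _ _ _ _ g
  (@sub_val_continuous g) (@grng_continuous G (val g))).
Qed.

Lemma sub_inv_continuous : continuous sub_inv.
Proof.
apply: sub_continuous => g; exact: (@continuous_comp _ _ _ _ _ g
  (@sub_val_continuous g) (@ginv_continuous G (val g))).
Qed.

Lemma sub_mul_continuous :
  {within [set p : H * H | sub_src p.1 = sub_rng p.2],
    continuous (fun p => sub_mul p.1 p.2)}.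
Proof.
apply/within_pairP => g h /= gh _ [W oW <-] Wgh.
have {}Wgh : W (val (sub_mul g h)) := Wgh; rewrite sub_mulE // in Wgh.
have /within_pairP /(_ (val g) (val h) gh W oW Wgh) := @gmul_continuous G.
move=> [U [V [oU Ug oV Vh UV]]].
exists (val @^-1` U), (val @^-1` V); split=> //; [by exists U|by exists V|].
move=> g' h' Ug' Vh' E; have : W (val (sub_mul g' h')); last by [].
by rewrite sub_mulE //; exact: UV.
Qed.

Lemma sub_src_local_homeo : local_homeo sub_src.
Proof.
move=> g; have [U [oU Ug Uinj _ Uopen]] := gsrc_local_homeo (val g).
exists (val @^-1` U); split=> //.
- by exists U.
- move=> h k /set_mem Uh /set_mem Uk /Uinj E.
  by apply: val_inj; apply: E; exact: mem_set.
- exact: continuous_subspaceT sub_src_continuous.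
move=> _ [V oV <-] VU.
have -> : sub_src @` (val @^-1` V) = @gsrc G @` (V `&` H).
  apply/seteqP; split=> x.
    by move=> [h Vh <-]; exists (val h) => //; split=> //; exact: sub_arrP.
  by move=> [h [Vh Hh] <-]; exists (sub_arr Hh).
apply: Uopen; first exact: openI.
by move=> h [Vh Hh]; exact: (VU (sub_arr Hh)).
Qed.

Definition open_subgroupoid : etale_groupoid :=
  EtaleGroupoid sub_src_unit sub_rng_unit sub_src_mul sub_rng_mul sub_mulA
    sub_mul1 sub_1mul sub_src_inv sub_rng_inv sub_mulV sub_Vmul
    sub_unit_continuous sub_src_continuous sub_rng_continuous
    sub_mul_continuous sub_inv_continuous sub_src_local_homeo.

End OpenSubgroupoid.

(** * Small categories *)

(* A small category is given by its set of morphisms; an object is identified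
   with its identity morphism, so that domain and target are morphisms.  The
   composite [cmp c d] is only meaningful when [dm c = tg d]. *)
Record small_category := SmallCategory {
  mor :> Type;
  dm : mor -> mor;
  tg : mor -> mor;
  cmp : mor -> mor -> mor;
  dm_dm : forall c, dm (dm c) = dm c;
  tg_dm : forall c, tg (dm c) = dm c;
  dm_tg : forall c, dm (tg c) = tg c;
  tg_tg : forall c, tg (tg c) = tg c;
  dm_cmp : forall c d, dm c = tg d -> dm (cmp c d) = dm d;
  tg_cmp : forall c d, dm c = tg d -> tg (cmp c d) = tg c;
  cmp_dm : forall c, cmp c (dm c) = c;
  tg_cmpl : forall c, cmp (tg c) c = c;
  cmpA : forall c d e, dm c = tg d -> dm d = tg e ->
    cmp c (cmp d e) = cmp (cmp c d) e
}.

Definition left_cancellative (C : small_category) : Prop :=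
  forall c x y : C, dm c = tg x -> dm c = tg y -> cmp c x = cmp c y -> x = y.

Record lc_category := LcCategory {
  lc_cat :> small_category;
  lc_cancel : left_cancellative lc_cat
}.

Section Categories.
Variable C : small_category.
Implicit Types (c u v : C) (S : set C).

Definition objects : set C := [set v | dm v = v].

(* $cS$ *)
Definition ltrans c S : set C :=
  [set y | exists s, [/\ S s, tg s = dm c & y = cmp c s]].

(* $c\mathfrak C$ *)
Definition rideal c : set C := ltrans c setT.

(* $\mathfrak C^*$ *)
Definition invertibles : set C :=
  [set u | exists w, [/\ dm u = tg w, dm w = tg u,
                         cmp u w = tg u & cmp w u = dm u]].

(* $\mathfrak v\mathfrak C^*\mathfrak v$ *)
Definition invertibles_at v : set C :=
  [set u | [/\ invertibles u, tg u = v & dm u = v]].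

(* $\mathfrak C^{*,0}$ *)
Definition invertibles0 : set C := [set u | invertibles u /\ tg u = dm u].

(* Partial bijections are represented by their graphs. *)
Definition lmul c : set (C * C) :=
  [set xy | rideal (dm c) xy.1 /\ xy.2 = cmp c xy.1].

Definition pdom (s : set (C * C)) : set C := [set x | exists y, s (x, y)].

Definition pid (e : set C) : set (C * C) := [set xy | e xy.1 /\ xy.2 = xy.1].

(* [(s \; t)] is "first [t], then [s]". *)
Inductive inv_hull : set (C * C) -> Prop :=
| hull_lmul c : inv_hull (lmul c)
| hull_comp s t : inv_hull s -> inv_hull t -> inv_hull (s \; t)%relation
| hull_inv s : inv_hull s -> inv_hull (s^-1)%relation.

(* $\mathcal J$ *)
Definition constructible : set (set C) :=
  [set e | exists2 s, inv_hull s & e = pdom s].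

(* $s^{-1}(e)$, the domain of $s^{-1} e s$ *)
Definition ppre (s : set (C * C)) (e : set C) : set C :=
  [set x | exists2 y, s (x, y) & e y].

Lemma ridealE v : dm v = v -> rideal v = [set x | tg x = v].
Proof.
move=> dv; have tv : tg v = v by rewrite -{1}dv tg_dm dv.
apply/seteqP; split=> [y [s [_ ts ->]]|x /= tx].
  by rewrite /= tg_cmp // ts.
by exists x; split=> //; [rewrite tx dv | rewrite -tx tg_cmpl].
Qed.

Lemma lmulE c x y : lmul c (x, y) <-> tg x = dm c /\ y = cmp c x.
Proof. by rewrite /lmul /= ridealE ?dm_dm. Qed.

Lemma pdom_lmul c : pdom (lmul c) = rideal (dm c).
Proof.
by apply/seteqP; split=> [x [y []]|x xc] //; exists (cmp c x).
Qed.

Lemma pdom_pid e : pdom (pid e) = e.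
Proof. by apply/seteqP; split=> [x [y []]|x ex] //; exists x. Qed.

End Categories.

Section LeftInverseHull.
Variable C : lc_category.
Implicit Types (c : C) (s t : set (C * C)) (e f : set C).

Lemma inv_hull_bij s : inv_hull s ->
  (forall x y z, s (x, y) -> s (x, z) -> y = z) /\
  (forall x y z, s (x, z) -> s (y, z) -> x = y).
Proof.
elim=> {s} [c|s t _ [sf si] _ [tf ti]|s _ [sf si]].
- split=> [x y z|x y z] /lmulE[tx E] /lmulE[ty E']; first by rewrite E E'.
  by apply: (@lc_cancel C c); rewrite ?tx ?ty // -E.
- split=> x y z /= [w t1 s1] [w' t2 s2].
    by move: t2 s2 => /(tf _ _ _ t1) <- /(sf _ _ _ s1).
  by move: s2 t2 => /(si _ _ _ s1) <- /(ti _ _ _ t1).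
- by split=> x y z /= ? ?; [apply: si | apply: sf]; eassumption.
Qed.

Lemma pid_pdom s : inv_hull s -> (s^-1 \; s)%relation = pid (pdom s).
Proof.
move=> /inv_hull_bij[sf si]; apply/seteqP; split=> -[x y] /=.
  by move=> [z s1 s2]; split; [exists z | exact: si s2 s1].
by move=> [[z /= sz] ->]; exists z.
Qed.

Lemma inv_hull_pid e : constructible e -> inv_hull (pid e).
Proof.
move=> [s hs ->]; rewrite -pid_pdom //.
by apply: hull_comp => //; exact: hull_inv.
Qed.

Lemma ppre_constructible s e :
  inv_hull s -> constructible e -> constructible (ppre s e).
Proof.
move=> hs [t ht ->]; exists (t \; s)%relation; first exact: hull_comp.
apply/seteqP; split=> [x [y sxy [z tyz]]|x [z /= [y sxy tyz]]].
  by exists z, y.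
by exists y => //; exists z.
Qed.

Lemma constructibleI e f :
  constructible e -> constructible f -> constructible (e `&` f).
Proof.
move=> ce cf; have := ppre_constructible (inv_hull_pid ce) cf.
congr constructible; apply/seteqP; split=> [x [y [/= ex ->]]|x [ex fx]] //.
by exists x.
Qed.

End LeftInverseHull.

Record Il (C : lc_category) :=
  MkIl { il :> set (C * C); ilP : inv_hull il }.

Record J (C : lc_category) :=
  MkJ { jset :> set C; jsetP : constructible jset }.

HB.instance Definition _ C := gen_eqMixin (J C).
HB.instance Definition _ C := gen_choiceMixin (J C).

Section TransformationGroupoid.
Variable C : lc_category.
Local Notation Il := (Il C).
Local Notation J := (J C).
Implicit Types (c : C) (s t : Il) (e f : J).

Lemma il_inj (s t : Il) : il s = il t -> s = t.
Proof.
by case: s t => s hs [t ht] /= st; subst t; congr MkIl; exact: Prop_irrelevance.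
Qed.

Lemma jset_inj (e f : J) : jset e = jset f -> e = f.
Proof.
by case: e f => e he [f hf] /= ef; subst f; congr MkJ; exact: Prop_irrelevance.
Qed.

Definition il_lmul c : Il := MkIl (hull_lmul c).
Definition il_comp (s t : Il) : Il := MkIl (hull_comp (ilP s) (ilP t)).
Definition il_inv (s : Il) : Il := MkIl (hull_inv (ilP s)).
Definition il_id (e : J) : Il := MkIl (inv_hull_pid (jsetP e)).

(* $s^{-1}s$ *)
Definition jdom (s : Il) : J :=
  @MkJ C (pdom s) (ex_intro2 _ _ (il s) (ilP s) erefl).
Definition jcap (e f : J) : J := MkJ (constructibleI (jsetP e) (jsetP f)).
(* $s^{-1}es$ *)
Definition jpre (s : Il) (e : J) : J :=
  MkJ (ppre_constructible (ilP s) (jsetP e)).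

Definition characters : set {ptws J -> bool} :=
  [set chi : J -> bool | [/\ exists e, chi e,
     forall e f, chi (jcap e f) = chi e && chi f &
     forall e : J, e = set0 :> set C -> chi e = false]].

Definition Omega : set {ptws J -> bool} :=
  [set chi : J -> bool | characters chi /\
     forall (e : J) (n : nat) (f : 'I_n -> J),
       e = \bigcup_i f i :> set C -> chi e -> exists i, chi (f i)].

Definition chr (chi : Omega) : J -> bool := val chi.

(* $\Omega(e)$ *)
Definition Omega_at (e : J) : set Omega := [set chi | chr chi e].

Lemma chr_inj (chi psi : Omega) : chr chi = chr psi -> chi = psi.
Proof. exact: val_inj. Qed.

Lemma chrP (chi : Omega) : Omega (chr chi).
Proof. exact: set_mem (valP chi). Qed.

Lemma chr_ex (chi : Omega) : exists e, chr chi e.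
Proof. by case: (chrP chi) => -[]. Qed.

Lemma chrI (chi : Omega) e f : chr chi (jcap e f) = chr chi e && chr chi f.
Proof. by case: (chrP chi) => -[]. Qed.

Lemma chr0 (chi : Omega) (e : J) : chr chi e -> e !=set0.
Proof.
move=> ce; apply/set0P/eqP => e0.
by case: (chrP chi) => -[_ _ /(_ e e0)]; rewrite ce.
Qed.

Lemma chr_le (chi : Omega) (e f : J) : e `<=` f -> chr chi e -> chr chi f.
Proof.
move=> ef; have -> : e = jcap e f by apply: jset_inj; rewrite /= setIidl.
by rewrite chrI => /andP[].
Qed.

Lemma chr_local (chi : Omega) (e f k : J) : chr chi k ->
  e `&` k = f `&` k -> chr chi e = chr chi f.
Proof.
move=> ck efk; have : jcap e k = jcap f k by exact: jset_inj.
by move=> /(congr1 (chr chi)); rewrite !chrI ck !andbT.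
Qed.

(** * The action of $I_l$ on $\Omega$ *)

(* $\chi(s^{-1}\cdot s)$ *)
Definition twist (s : Il) (chi : {ptws J -> bool}) : {ptws J -> bool} :=
  fun e : J => chi (jpre s e).

Lemma twist_Omega (s : Il) (chi : Omega) :
  Omega_at (jdom s) chi -> Omega (twist s (val chi)).
Proof.
rewrite /Omega_at /= => cs; have [sf si] := inv_hull_bij (ilP s).
split; last first.
  move=> e n f ef ce; have := (chrP chi).2 (jpre s e) n (fun i => jpre s (f i)).
  apply=> //=; rewrite ef; apply/seteqP; split=> x.
    by move=> [y sxy [i _ fi]]; exists i => //; exists y.
  by move=> [i _ [y sxy fi]]; exists y => //; exists i.
split.
- exists (jdom (il_inv s)); apply: chr_le cs => x [y sxy].
  by exists y => //; exists x.
- move=> e f; rewrite /twist; rewrite -[RHS]chrI; congr chr.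
  apply: jset_inj; apply/seteqP; split=> x /=.
    by move=> [y sxy [ey fy]]; split; exists y.
  move=> [[y sxy ey] [z sxz fz]]; exists y => //; split=> //.
  by rewrite (sf _ _ _ sxy sxz).
- move=> e e0; apply/negbTE/negP => /(@chr0 chi)[x [y _]].
  by rewrite e0.
Qed.

Definition act (s : Il) (chi : Omega) (H : Omega_at (jdom s) chi) : Omega :=
  exist _ (twist s (val chi)) (mem_set (twist_Omega H)).

Lemma chr_act s chi (H : Omega_at (jdom s) chi) e :
  chr (act H) e = chr chi (jpre s e).
Proof. by []. Qed.

Lemma act_inv_dom s chi (H : Omega_at (jdom s) chi) :
  Omega_at (jdom (il_inv s)) (act H).
Proof.
rewrite /Omega_at /= chr_act; apply: chr_le H => x [y sxy].
by exists y => //; exists x.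
Qed.

Lemma act_comp_dom s t chi (H : Omega_at (jdom t) chi) :
  Omega_at (jdom s) (act H) -> Omega_at (jdom (il_comp s t)) chi.
Proof.
rewrite /Omega_at /= chr_act; apply: chr_le => x [y sxy [z tyz]].
by exists z, y.
Qed.

Lemma act_comp s t chi (H : Omega_at (jdom t) chi)
    (K : Omega_at (jdom s) (act H)) (L : Omega_at (jdom (il_comp s t)) chi) :
  act L = act K.
Proof.
apply: chr_inj; apply: funext => e; rewrite !chr_act.
congr chr; apply: jset_inj; apply/seteqP; split=> x /=.
  by move=> [z /= [y txy syz] ez]; exists y => //; exists z.
by move=> [y txy [z syz ez]]; exists z => //=; exists y.
Qed.

Lemma act_inv s chi (H : Omega_at (jdom s) chi)
  (K : Omega_at (jdom (il_inv s)) (act H)) : act K = chi.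
Proof.
have [sf si] := inv_hull_bij (ilP s).
apply: chr_inj; apply: funext => e; rewrite !chr_act.
apply: (chr_local H); apply/seteqP; split=> x [] /=.
  by move=> [y sxy [z /= szy ez]] dx; split=> //; rewrite (si _ _ _ sxy szy).
by move=> ex [y sxy]; split; [exists y => //; exists x | exists y].
Qed.

Lemma act_id e chi (H : Omega_at (jdom (il_id e)) chi) : act H = chi.
Proof.
apply: chr_inj; apply: funext => f; rewrite chr_act.
apply: (chr_local H); apply/seteqP; split=> x [] /=.
  by move=> [y [/= ex ->] fx] dx; split.
by move=> fx [y [/= ex exy]]; split; exists x.
Qed.

Lemma id_dom e chi : chr chi e -> Omega_at (jdom (il_id e)) chi.
Proof. by apply: chr_le; rewrite /= pdom_pid. Qed.

Lemma id_domV e chi : Omega_at (jdom (il_id e)) chi -> chr chi e.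
Proof. by apply: chr_le; rewrite /= pdom_pid. Qed.

(** * The transformation groupoid *)

Record pregerm := Pregerm {
  pg_il : Il;
  pg_chr : Omega;
  pg_dom : Omega_at (jdom pg_il) pg_chr
}.

HB.instance Definition _ := gen_eqMixin pregerm.
HB.instance Definition _ := gen_choiceMixin pregerm.

(* [il s \; pid e] is the product $se$ in $I_l$. *)
Definition germ_equiv (p q : pregerm) : Prop :=
  pg_chr p = pg_chr q /\
  exists2 e : J, chr (pg_chr p) e &
    (il (pg_il p) \; pid e)%relation = (il (pg_il q) \; pid e)%relation.

Lemma comp_pidE (s : set (C * C)) (e : set C) x y :
  (s \; pid e)%relation (x, y) <-> e x /\ s (x, y).
Proof.
split; first by move=> [z [/= ex ->]].
by move=> [ex sxy]; exists x.
Qed.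

Lemma comp_pid_eqP (s t : set (C * C)) (e : set C) :
  (s \; pid e)%relation = (t \; pid e)%relation <->
  (forall x y, e x -> s (x, y) <-> t (x, y)).
Proof.
split=> [E x y ex|E].
  split=> K.
    have : (s \; pid e)%relation (x, y) by apply/comp_pidE.
    by rewrite E => /comp_pidE[].
  have : (t \; pid e)%relation (x, y) by apply/comp_pidE.
  by rewrite -E => /comp_pidE[].
apply/seteqP; split=> -[x y] /comp_pidE[ex sxy]; apply/comp_pidE.
  by split=> //; apply/E.
by split=> //; apply/E.
Qed.

Lemma germ_equiv_refl p : germ_equiv p p.
Proof. by split=> //; have [e ce] := chr_ex (pg_chr p); exists e. Qed.

Lemma germ_equiv_sym p q : germ_equiv p q -> germ_equiv q p.
Proof. by move=> [pq [e ce E]]; split=> //; exists e => //; rewrite -pq. Qed.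

Lemma germ_equiv_trans (q p r : pregerm) :
  germ_equiv p q -> germ_equiv q r -> germ_equiv p r.
Proof.
move=> [pq [e ce /comp_pid_eqP E]] [qr [f cf /comp_pid_eqP F]].
split; first by rewrite pq.
exists (jcap e f); first by rewrite chrI ce pq.
by apply/comp_pid_eqP => x y [ex fx]; rewrite E // F.
Qed.

Definition germ_eqb (p q : pregerm) : bool := `[< germ_equiv p q >].

Lemma germ_eqb_refl : reflexive germ_eqb.
Proof. by move=> p; apply/asboolP; exact: germ_equiv_refl. Qed.

Lemma germ_eqb_sym : symmetric germ_eqb.
Proof. by move=> p q; apply/asboolP/asboolP; exact: germ_equiv_sym. Qed.

Lemma germ_eqb_trans : transitive germ_eqb.
Proof.
move=> p q r /asboolP pq /asboolP qr; apply/asboolP.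
exact: germ_equiv_trans pq qr.
Qed.

Canonical germ_equiv_rel :=
  EquivRel germ_eqb germ_eqb_refl germ_eqb_sym germ_eqb_trans.

Definition germ := {eq_quot germ_eqb}%qT.

HB.instance Definition _ := Choice.on germ.

(* $[s,\chi]$, for $\chi\in\Omega(s^{-1}s)$ *)
Definition mk_germ s (chi : Omega) (H : Omega_at (jdom s) chi) : germ :=
  (\pi_germ (Pregerm H))%qT.

Lemma mk_germ_eqP s t (chi psi : Omega) (H : Omega_at (jdom s) chi)
    (K : Omega_at (jdom t) psi) :
  mk_germ H = mk_germ K <-> germ_equiv (Pregerm H) (Pregerm K).
Proof.
rewrite /mk_germ; split=> [/eqmodP/asboolP //|E].
by apply/eqmodP/asboolP.
Qed.

Lemma mk_germ_eq s t (chi psi : Omega) (H : Omega_at (jdom s) chi)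
    (K : Omega_at (jdom t) psi) e :
  chi = psi -> chr chi e ->
  (forall x y, jset e x -> il s (x, y) <-> il t (x, y)) -> mk_germ H = mk_germ K.
Proof.
move=> cp ce E; apply/mk_germ_eqP; split=> //=.
by exists e => //; apply/comp_pid_eqP.
Qed.

Arguments mk_germ_eq {s t chi psi H K} e.

Lemma mk_germ_inj s t (chi psi : Omega) (H : Omega_at (jdom s) chi)
    (K : Omega_at (jdom t) psi) :
  mk_germ H = mk_germ K -> chi = psi /\ exists2 e, chr chi e &
    (forall x y, jset e x -> il s (x, y) <-> il t (x, y)).
Proof.
by move=> /mk_germ_eqP[/= -> [e ce /comp_pid_eqP E]]; split=> //; exists e.
Qed.

Lemma mk_germ_irr s (chi psi : Omega) (H : Omega_at (jdom s) chi)
    (K : Omega_at (jdom s) psi) :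
  chi = psi -> mk_germ H = mk_germ K.
Proof. by move=> cp; apply: (mk_germ_eq (jdom s)) => //. Qed.

Lemma germ_ind (P : germ -> Prop) :
  (forall s chi (H : Omega_at (jdom s) chi), P (mk_germ H)) -> forall g : germ, P g.
Proof. by move=> h; apply: quotW => -[s chi H]; exact: h. Qed.

Lemma repr_germK (g : germ) : mk_germ (pg_dom (repr g : pregerm)) = g.
Proof. by rewrite -[RHS]reprK /mk_germ; case: (repr g). Qed.

Definition germ_src (g : germ) : Omega := pg_chr (repr g).

Definition germ_rng (g : germ) : Omega := act (pg_dom (repr g)).

Lemma germ_srcE s chi (H : Omega_at (jdom s) chi) : germ_src (mk_germ H) = chi.
Proof. by have /mk_germ_inj[] := repr_germK (mk_germ H). Qed.

Lemma act_germ s t (chi psi : Omega) (H : Omega_at (jdom s) chi)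
    (K : Omega_at (jdom t) psi) : mk_germ H = mk_germ K -> act H = act K.
Proof.
move=> /mk_germ_inj[cp [e ce E]]; apply: chr_inj; apply: funext => f.
rewrite !chr_act -cp; apply: (chr_local ce); apply/seteqP.
split=> x [] [y sxy fy] ex; split=> //; exists y => //; exact/E.
Qed.

Lemma germ_rngE s chi (H : Omega_at (jdom s) chi) :
  germ_rng (mk_germ H) = act H.
Proof. by apply: act_germ; rewrite repr_germK. Qed.

(* the unit $[e,\chi]$, for any $e$ with $\chi(e)=1$ *)
Definition germ_unit (chi : Omega) : germ :=
  mk_germ (id_dom (svalP (cid (chr_ex chi)))).

Lemma germ_unitE e chi (H : Omega_at (jdom (il_id e)) chi) :
  germ_unit chi = mk_germ H.
Proof.
rewrite /germ_unit; case: cid => f cf.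
apply: (mk_germ_eq (jcap e f)) => //.
  by rewrite chrI cf andbT; exact: id_domV.
by move=> x y [ex fx]; split=> -[_ /= yx]; split.
Qed.

Lemma germ_mul_dom (g h : germ) : germ_src g = germ_rng h ->
  Omega_at (jdom (il_comp (pg_il (repr g)) (pg_il (repr h))))
    (pg_chr (repr h)).
Proof.
rewrite /germ_src /germ_rng => E.
by apply: (act_comp_dom (H := pg_dom (repr h))); rewrite -E; exact: pg_dom.
Qed.

(* $[s,t.\chi][t,\chi]=[st,\chi]$ *)
Definition germ_mul (g h : germ) : germ :=
  if pselect (germ_src g = germ_rng h) is left E then mk_germ (germ_mul_dom E)
  else g.

Lemma germ_mulE s t (chi psi : Omega) (H : Omega_at (jdom t) chi)
    (K : Omega_at (jdom s) psi) (L : Omega_at (jdom (il_comp s t)) chi) :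
  psi = act H -> germ_mul (mk_germ K) (mk_germ H) = mk_germ L.
Proof.
move=> psiE; rewrite /germ_mul; case: pselect => [E|nE]; last first.
  by case: nE; rewrite germ_srcE germ_rngE.
have /mk_germ_inj[p1 [e ce sE]] := repr_germK (mk_germ K).
have /mk_germ_inj[p2 [f cf tE]] := repr_germK (mk_germ H).
have [tf _] := inv_hull_bij (ilP t).
apply: (mk_germ_eq (jcap f (jpre t e))) => //.
  by rewrite chrI cf p2 -(chr_act H) -psiE -p1.
move=> x z [fx [y txy ey]]; split=> -[w /= xw wz].
  have {}xw : il t (x, w) by apply/tE.
  exists w => //=; apply/sE => //.
  by rewrite (tf _ _ _ xw txy).
exists w => /=; first exact/tE.
by apply/sE => //; rewrite (tf _ _ _ xw txy).
Qed.

Arguments germ_mulE {s t chi psi H K} L.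

(* $[s,\chi]^{-1}=[s^{-1},s.\chi]$ *)
Definition germ_inv (g : germ) : germ :=
  mk_germ (act_inv_dom (pg_dom (repr g))).

Lemma germ_invE s chi (H : Omega_at (jdom s) chi) psi
    (K : Omega_at (jdom (il_inv s)) psi) :
  psi = act H -> germ_inv (mk_germ H) = mk_germ K.
Proof.
move=> psiE; rewrite /germ_inv.
have /mk_germ_inj[p1 [e ce sE]] := repr_germK (mk_germ H).
have actE : act (pg_dom (repr (mk_germ H))) = act H.
  by apply: act_germ; rewrite repr_germK.
have [sf si] := inv_hull_bij (ilP s).
have [rf ri] := inv_hull_bij (ilP (pg_il (repr (mk_germ H)))).
have [e' ce' e'E] : exists2 e' : J, chr (act H) e' &
    forall y, jset e' y -> exists2 x, jset e x & il s (x, y).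
  exists (jpre (il_inv s) (jcap e (jdom s))); last first.
    by move=> y /= [x sxy [ex _]]; exists x.
  rewrite chr_act; apply: (@chr_le _ (jcap e (jdom s))).
    move=> x [ex [y sxy]]; exists y => //; exists x => //.
    by split=> //; exists y.
  by rewrite chrI -p1 ce p1.
apply: (mk_germ_eq e'); rewrite ?actE //.
move=> y x /= /e'E[z ez szy]; have rzy := (sE z y ez).2 szy.
split=> h; first by rewrite (ri _ _ _ h rzy).
by rewrite (si _ _ _ h szy).
Qed.

Arguments germ_invE {s chi H psi} K.

(** ** Topology *)

(* $\{[s,\chi]:\chi\in U\cap\Omega(s^{-1}s)\}$ *)
Definition germ_slice s (U : set Omega) : set germ :=
  [set g | exists chi, exists2 H : Omega_at (jdom s) chi, U chi & g = mk_germ H].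

(* $\{\chi\in\Omega(s^{-1}s):[s,\chi]\in W\}$ *)
Definition germ_trace s (W : set germ) : set Omega :=
  [set chi | exists H : Omega_at (jdom s) chi, W (mk_germ H)].

Definition germ_open (W : set germ) : Prop := forall s, open (germ_trace s W).

Lemma germ_traceP s (W : set germ) chi (H : Omega_at (jdom s) chi) :
  germ_trace s W chi <-> W (mk_germ H).
Proof.
split=> [[K WK]|WH]; last by exists H.
by rewrite (mk_germ_irr H K).
Qed.

Lemma open_Omega_at e : open (Omega_at e).
Proof.
have -> : Omega_at e = set_val @^-1` [set phi : {ptws J -> bool} | phi e].
  by apply/seteqP; split.
apply: open_comp; first by move=> + _; exact: initial_continuous.
have -> : [set phi : {ptws J -> bool} | phi e] =
  proj e @^-1` [set b : bool | b] by apply/seteqP; split.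
apply: open_comp; first by move=> + _; exact: proj_continuous.
exact: discrete_open.
Qed.

Lemma germ_openT : germ_open setT.
Proof.
move=> s; have -> : germ_trace s setT = Omega_at (jdom s).
  by apply/seteqP; split=> [chi []|chi H] //; exists H.
exact: open_Omega_at.
Qed.

Lemma germ_openI : setI_closed germ_open.
Proof.
move=> V W oV oW s.
have -> : germ_trace s (V `&` W) = germ_trace s V `&` germ_trace s W.
  apply/seteqP; split=> chi.
    by move=> [H [VH WH]]; split; exists H.
  by move=> [[H VH] /(germ_traceP _ H) WH]; exists H.
exact: openI.
Qed.

Lemma germ_open_bigU (I : Type) (f : I -> set germ) :
  (forall i, germ_open (f i)) -> germ_open (\bigcup_i f i).
Proof.
move=> of_ s.
have -> : germ_trace s (\bigcup_i f i) = \bigcup_i germ_trace s (f i).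
  apply/seteqP; split=> chi.
    by move=> [H [i _ fi]]; exists i => //; exists H.
  by move=> [i _ [H fi]]; exists H; exists i.
by apply: bigcup_open => i _; exact: of_.
Qed.

(* The lemmas [germ_slice_open], [germ_src_slice], [germ_src_inj],
   [germ_src_continuous] and [germ_src_open] show that, for this topology, the
   sets [germ_slice s setT] are open and the source map restricts to
   homeomorphisms from them onto [Omega_at (jdom s)]; it is the only such
   topology. *)
HB.instance Definition _ :=
  isOpenTopological.Build germ germ_openT germ_openI germ_open_bigU.

Lemma germ_openE (W : set germ) : open W <-> germ_open W.
Proof. by []. Qed.

Lemma germ_slice_open s (U : set Omega) : open U -> open (germ_slice s U).
Proof.
move=> oU; apply/germ_openE => t.
have -> : germ_trace t (germ_slice s U) =
    \bigcup_(e in [set e : J |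
        forall x y, jset e x -> il t (x, y) <-> il s (x, y)])
      (U `&` Omega_at (jdom s) `&` Omega_at (jdom t) `&` Omega_at e).
  apply/seteqP; split=> chi.
    move=> [H [psi [K Upsi /mk_germ_inj[cp [e ce E]]]]].
    by exists e => //; subst psi.
  move=> [e E [[[Uchi K] H] ce]]; exists H, chi, K => //.
  exact: (mk_germ_eq e).
apply: bigcup_open => e _.
by do !apply: openI => //; exact: open_Omega_at.
Qed.

Lemma germ_src_slice s : germ_src @` germ_slice s setT = Omega_at (jdom s).
Proof.
apply/seteqP; split=> [_ [_ [chi [H _ ->]] <-]|chi H]; first by rewrite germ_srcE.
by exists (mk_germ H); [exists chi, H | rewrite germ_srcE].
Qed.

Lemma germ_src_inj s : set_inj (germ_slice s setT) germ_src.
Proof.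
move=> _ _ /set_mem[chi [H _ ->]] /set_mem[psi [K _ ->]].
by rewrite !germ_srcE => cp; exact: mk_germ_irr.
Qed.

Lemma germ_src_continuous : continuous germ_src.
Proof.
apply/continuousP => U oU; apply/germ_openE => s.
have -> : germ_trace s (germ_src @^-1` U) = U `&` Omega_at (jdom s).
  apply/seteqP; split=> chi; first by move=> [H] /=; rewrite germ_srcE.
  by move=> [Uchi H]; exists H; rewrite /= germ_srcE.
by apply: openI => //; exact: open_Omega_at.
Qed.

Lemma germ_src_open (W : set germ) : open W -> open (germ_src @` W).
Proof.
move=> oW; have -> : germ_src @` W = \bigcup_s germ_trace s W.
  apply/seteqP; split=> chi.
    by move=> [g + <-]; elim/germ_ind: g => s psi H WH;
      rewrite germ_srcE; exists s => //; exists H.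
  by move=> [s _ [H WH]]; exists (mk_germ H) => //; rewrite germ_srcE.
by apply: bigcup_open => s _; exact: oW.
Qed.

Lemma twist_continuous s : continuous (twist s).
Proof.
move=> phi; apply/cvg_sup => e A [_ [[B oB <-] Bphi] sBA].
have nB : nbhs (phi (jpre s e)) B by exact: open_nbhs_nbhs.
have := @proj_continuous J (fun=> bool) (jpre s e) phi B nB.
by apply: (@filterS _ (nbhs phi)) => psi Bpsi; exact: sBA.
Qed.

Lemma act_open s (U : set Omega) : open U ->
  open [set chi | exists H : Omega_at (jdom s) chi, U (act H)].
Proof.
move=> [V oV VU].
have -> : [set chi | exists H : Omega_at (jdom s) chi, U (act H)] =
    Omega_at (jdom s) `&` set_val @^-1` (twist s @^-1` V).
  rewrite -VU; apply/seteqP; split=> chi; first by move=> [H].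
  by move=> [H]; exists H.
apply: openI; first exact: open_Omega_at.
apply: open_comp; first by move=> + _; exact: initial_continuous.
by apply: open_comp => // + _; exact: twist_continuous.
Qed.

Lemma germ_rng_continuous : continuous germ_rng.
Proof.
apply/continuousP => U oU; apply/germ_openE => s.
have -> : germ_trace s (germ_rng @^-1` U) =
    [set chi | exists H : Omega_at (jdom s) chi, U (act H)].
  by apply/seteqP; split=> chi [H] /=; rewrite ?germ_rngE => UH; exists H;
    rewrite /= ?germ_rngE.
exact: act_open.
Qed.

Lemma germ_unit_continuous : continuous germ_unit.
Proof.
apply/continuousP => W /germ_openE oW.
have -> : germ_unit @^-1` W = \bigcup_e germ_trace (il_id e) W.
  apply/seteqP; split=> chi.
    move=> Wchi; have [e ce] := chr_ex chi; exists e => //.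
    by exists (id_dom ce); rewrite -germ_unitE.
  by move=> [e _ [H WH]]; rewrite /= (germ_unitE H).
by apply: bigcup_open => e _; exact: oW.
Qed.

Lemma germ_inv_continuous : continuous germ_inv.
Proof.
apply/continuousP => W /germ_openE oW; apply/germ_openE => s.
have -> : germ_trace s (germ_inv @^-1` W) =
    [set chi | exists H : Omega_at (jdom s) chi,
      germ_trace (il_inv s) W (act H)].
  apply/seteqP; split=> chi [H] /=.
    by rewrite (germ_invE (act_inv_dom H)) // => WH; exists H, (act_inv_dom H).
  by move=> [K WK]; exists H; rewrite /= (germ_invE K).
exact: act_open.
Qed.

Lemma germ_mul_continuous :
  {within [set p : germ * germ | germ_src p.1 = germ_rng p.2],
    continuous (fun p => germ_mul p.1 p.2)}.
Proof.
apply/within_pairP => g h /= gh W /germ_openE oW.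
elim/germ_ind: g gh => s psi K; elim/germ_ind: h => t chi H.
rewrite germ_srcE germ_rngE => E; subst psi.
have L := act_comp_dom K; rewrite (germ_mulE L) // => WL.
exists (germ_slice s setT), (germ_slice t (germ_trace (il_comp s t) W)).
split.
- exact: germ_slice_open openT.
- by exists (act H), K.
- exact: germ_slice_open.
- by exists chi, H => //; exists L.
move=> _ _ [psi1 [K1 _ ->]] [chi1 [H1 WL1 ->]].
rewrite germ_srcE germ_rngE => E1; subst psi1.
have L1 := act_comp_dom K1; rewrite (germ_mulE L1) //.
exact/germ_traceP.
Qed.

Lemma germ_src_local_homeo : local_homeo germ_src.
Proof.
elim/germ_ind => s chi H; exists (germ_slice s setT); split.
- exact: germ_slice_open openT.
- by exists chi, H.
- exact: germ_src_inj.
- exact: continuous_subspaceT germ_src_continuous.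
- by move=> V oV _; exact: germ_src_open.
Qed.

Lemma germ_rng_mul (g h : germ) :
  germ_src g = germ_rng h -> germ_rng (germ_mul g h) = germ_rng g.
Proof.
elim/germ_ind: g => s psi K; elim/germ_ind: h => t chi H.
rewrite germ_srcE germ_rngE => E; subst psi.
rewrite (germ_mulE (act_comp_dom K)) // !germ_rngE; exact: act_comp.
Qed.

Lemma germ_src_mul (g h : germ) :
  germ_src g = germ_rng h -> germ_src (germ_mul g h) = germ_src h.
Proof.
elim/germ_ind: g => s psi K; elim/germ_ind: h => t chi H.
rewrite germ_srcE germ_rngE => E; subst psi.
by rewrite (germ_mulE (act_comp_dom K)) // !germ_srcE.
Qed.

Lemma germ_mulA (g h k : germ) :
  germ_src g = germ_rng h -> germ_src h = germ_rng k ->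
  germ_mul g (germ_mul h k) = germ_mul (germ_mul g h) k.
Proof.
elim/germ_ind: g => s chi1 G; elim/germ_ind: h => t chi2 H.
elim/germ_ind: k => r chi3 K.
rewrite !germ_srcE !germ_rngE => E1 E2; subst chi2 chi1.
have HK := act_comp_dom H; have GH := act_comp_dom G.
rewrite (germ_mulE HK) // (germ_mulE GH) //.
have E : act H = act HK by rewrite (act_comp H).
have L : Omega_at (jdom (il_comp s (il_comp t r))) chi3.
  by apply: (@act_comp_dom s (il_comp t r) chi3 HK); rewrite -E.
have M : Omega_at (jdom (il_comp (il_comp s t) r)) chi3.
  exact: act_comp_dom GH.
rewrite (germ_mulE L) // (germ_mulE M) //.
apply: (mk_germ_eq (jdom r)) => //.
move=> x w _; split=> /= -[y].
  by move=> [z rxz tzy] syw; exists z => //; exists y.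
by move=> rxy [z tyz szw]; exists z => //; exists y.
Qed.

Lemma germ_mul1 (g : germ) : germ_mul g (germ_unit (germ_src g)) = g.
Proof.
elim/germ_ind: g => s chi H; rewrite germ_srcE.
have I := id_dom H; rewrite (germ_unitE I).
have E : chi = act I by rewrite act_id.
have L : Omega_at (jdom (il_comp s (il_id (jdom s)))) chi.
  by apply: (act_comp_dom (H := I)); rewrite -E.
rewrite (germ_mulE L) //; apply: (mk_germ_eq (jdom s)) => // x y dx.
by split=> [/comp_pidE[]|sxy] //; apply/comp_pidE.
Qed.

Lemma germ_unit_src (chi : Omega) : germ_src (germ_unit chi) = chi.
Proof. by rewrite germ_srcE. Qed.

Lemma germ_unit_rng (chi : Omega) : germ_rng (germ_unit chi) = chi.
Proof. by rewrite germ_rngE act_id. Qed.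

Lemma germ_1mul (g : germ) : germ_mul (germ_unit (germ_rng g)) g = g.
Proof.
elim/germ_ind: g => s chi H; rewrite germ_rngE.
have I := id_dom (act_inv_dom H); rewrite (germ_unitE I).
have L := act_comp_dom I.
rewrite (germ_mulE L) //; apply: (mk_germ_eq (jdom s)) => // x y dx.
split=> [[z /= sxz [_ /= ->]] //|sxy].
by exists y => //; split=> //=; exists x.
Qed.

Lemma germ_src_inv (g : germ) : germ_src (germ_inv g) = germ_rng g.
Proof. by rewrite germ_srcE. Qed.

Lemma germ_rng_inv (g : germ) : germ_rng (germ_inv g) = germ_src g.
Proof. by rewrite germ_rngE act_inv. Qed.

Lemma germ_Vmul (g : germ) : germ_mul (germ_inv g) g = germ_unit (germ_src g).
Proof.
elim/germ_ind: g => s chi H; rewrite germ_srcE.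
have K := act_inv_dom H; rewrite (germ_invE K) //.
have L := act_comp_dom K; rewrite (germ_mulE L) //.
have I := id_dom H; rewrite (germ_unitE I).
apply: (mk_germ_eq (jdom s)) => // x y dx.
by rewrite -[il (il_id _)](pid_pdom (ilP s)).
Qed.

Lemma germ_invK (g : germ) : germ_inv (germ_inv g) = g.
Proof.
elim/germ_ind: g => s chi H.
have K := act_inv_dom H; rewrite (germ_invE K) //.
rewrite (germ_invE (act_inv_dom K)) //.
by apply: (mk_germ_eq (jdom s)) => //; rewrite ?act_inv.
Qed.

Lemma germ_mulV (g : germ) : germ_mul g (germ_inv g) = germ_unit (germ_rng g).
Proof. by have := germ_Vmul (germ_inv g); rewrite germ_invK germ_src_inv. Qed.

(* $I_l\ltimes\Omega$ *)
Definition transformation_groupoid : etale_groupoid :=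
  EtaleGroupoid germ_unit_src germ_unit_rng germ_src_mul germ_rng_mul
    germ_mulA germ_mul1 germ_1mul germ_src_inv germ_rng_inv
    germ_mulV germ_Vmul germ_unit_continuous germ_src_continuous
    germ_rng_continuous germ_mul_continuous germ_inv_continuous
    germ_src_local_homeo.

(** ** The subgroupoid $\mathfrak C^{*,0}\ltimes\Omega$ *)

(* $[u,\chi]$ with $u\in\mathfrak C^{*,0}$ *)
Definition invertible_germs : set germ :=
  [set g | exists u, exists2 chi, exists H : Omega_at (jdom (il_lmul u)) chi,
     g = mk_germ H & invertibles0 u].

Lemma invertible_germs_open : open invertible_germs.
Proof.
have -> : invertible_germs =
    \bigcup_(u in @invertibles0 C) germ_slice (il_lmul u) setT.
  apply/seteqP; split=> g.
    by move=> [u [chi [H ->] iu]]; exists u => //; exists chi, H.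
  by move=> [u iu [chi [H _ ->]]]; exists u, chi => //; exists H.
by apply: bigcup_open => u _; exact: germ_slice_open openT.
Qed.

Lemma objects_invertible0 v : objects v -> @invertibles0 C v.
Proof.
move=> dv; have tv : tg v = v by rewrite -{1}dv tg_dm dv.
have vv : cmp v v = v by rewrite -{2}dv cmp_dm.
by split; [exists v; rewrite vv dv tv | rewrite dv tv].
Qed.

Lemma inv_hull_tg (r : set (C * C)) : inv_hull r -> exists v w : C,
  [/\ objects v, objects w & forall x y, r (x, y) -> tg x = v /\ tg y = w].
Proof.
elim=> {r} [c|r1 r2 _ [v [w [ov ow E]]] _ [v' [w' [ov' ow' E']]]
           |r _ [v [w [ov ow E]]]].
- exists (dm c), (tg c); split; [exact: dm_dm | exact: dm_tg |].
  by move=> x y /lmulE[tx ->]; rewrite tg_cmp.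
- by exists v', w; split=> // x y [z /= /E'[tx _] /E[_ ty]].
- by exists w, v; split=> // x y /= /E[].
Qed.

Lemma invertible_germs_unit (chi : Omega) : invertible_germs (germ_unit chi).
Proof.
have [e ce] := chr_ex chi; have [r hr er] := jsetP e.
have [v [w [ov _ E]]] := inv_hull_tg hr.
have H : Omega_at (jdom (il_lmul v)) chi.
  apply: chr_le ce; rewrite er => x [y /E[tx _]].
  by exists (cmp v x); apply/lmulE; rewrite tx ov.
exists v, chi; last exact: objects_invertible0.
exists H; rewrite (germ_unitE (id_dom ce)); apply: (mk_germ_eq e) => // x y.
rewrite er => ex; have [z /E[tx _]] := ex.
have vx : cmp v x = x by rewrite -tx tg_cmpl.
split=> [[_ /= ->]|/lmulE[_ ->]]; first by apply/lmulE; rewrite tx ov vx.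
by split; rewrite /= ?er.
Qed.

Lemma invertibles0_mul u v : invertibles0 u -> invertibles0 v ->
  dm u = tg v -> @invertibles0 C (cmp u v).
Proof.
move=> [[u' [du du' uu' u'u]] tu] [[v' [dv dv' vv' v'v]] tv] uv.
have E1 : dm v' = tg u' by rewrite dv' -du.
split; last by rewrite tg_cmp // dm_cmp // tu uv.
exists (cmp v' u'); split.
- by rewrite dm_cmp // tg_cmp.
- by rewrite dm_cmp // tg_cmp.
- rewrite tg_cmp // -cmpA ?tg_cmp // (cmpA (d := v')) // vv'.
  by rewrite -uv du tg_cmpl.
- rewrite dm_cmp // -cmpA ?tg_cmp // (cmpA (d := u)) // u'u.
  by rewrite uv tg_cmpl.
Qed.

Lemma invertible_germs_mul (g h : germ) : germ_src g = germ_rng h ->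
  invertible_germs g -> invertible_germs h -> invertible_germs (germ_mul g h).
Proof.
move=> E Hg Hh; move: Hg Hh E.
move=> [u [psi [K ->] iu]] [v [chi [H ->] iv]].
rewrite germ_srcE germ_rngE => E; subst psi.
have uv : dm u = tg v.
  have [x [y /lmulE[tx ->] [z /lmulE[<- _]]]] :=
    chr0 (K : chr chi (jpre (il_lmul v) (jdom (il_lmul u)))).
  by rewrite tg_cmp.
exists (cmp u v), chi; last exact: invertibles0_mul.
have M : Omega_at (jdom (il_lmul (cmp u v))) chi.
  apply: chr_le (H) => x [_ /lmulE[tx _]].
  by exists (cmp (cmp u v) x); apply/lmulE; rewrite dm_cmp.
exists M; rewrite (germ_mulE (act_comp_dom K)) //.
apply: (mk_germ_eq (jdom (il_lmul v))) => // x y [_ /lmulE[tx _]].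
split.
  move=> [z /= /lmulE[_ ->] /lmulE[_ ->]]; apply/lmulE.
  by rewrite dm_cmp // cmpA.
move=> /lmulE[_ ->]; exists (cmp v x) => /=; apply/lmulE => //.
by rewrite tg_cmp // cmpA.
Qed.

Lemma invertible_germs_inv (g : germ) :
  invertible_germs g -> invertible_germs (germ_inv g).
Proof.
move=> [u [chi [H ->] [[w [du dw uw wu]] tu]]].
have E x y : il (il_inv (il_lmul u)) (x, y) <-> il (il_lmul w) (x, y).
  split=> /lmulE[/= tz ->]; apply/lmulE => /=.
    by rewrite tg_cmp // dw cmpA // wu -tz tg_cmpl.
  by rewrite tg_cmp // du cmpA // uw -dw -tz tg_cmpl.
have K : Omega_at (jdom (il_lmul w)) (act H).
  by apply: chr_le (act_inv_dom H) => x [y] /E xy; exists y.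
exists w, (act H); last first.
  by split; [exists u; split; rewrite // ?wu ?uw | rewrite dw -du tu].
exists K; rewrite (germ_invE (act_inv_dom H)) //.
by apply: (mk_germ_eq (jdom (il_lmul w))) => // x y _; exact: E.
Qed.

Definition invertible_groupoid : etale_groupoid :=
  @open_subgroupoid transformation_groupoid
    invertible_germs invertible_germs_open
    invertible_germs_unit invertible_germs_mul invertible_germs_inv.

End TransformationGroupoid.

Arguments Omega C : clear implicits.
Arguments characters C : clear implicits.
Arguments germ C : clear implicits.

(* Main.v *)
Require Import Defs.
From mathcomp Require Import all_boot all_classical.
From mathcomp Require Import topology.

(** The points of [C] give the principal characters [e |-> (x \in e)], which
    belong to [Omega] and are dense there, because a basic open set cut out by
    finitely many constructible ideals contains a character only if some [x]
    satisfies the same conditions ([basic_open_point]).  The left inverse hull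
    acts on them by evaluation, [s.chi_x = chi_(s x)] ([act_principal]).  Every
    [s] in the hull commutes with right translations ([inv_hull_cmp]); hence
    the germ of [s] at [chi_x] is a unit as soon as [s x = x], and two
    principal characters [chi_x] and [chi_y] agree exactly when [y] lies in
    [x C^*] ([principal_eqP]).  So both isotropy and units are visible on
    points, and the equivalence follows from three implications.

    Topological freeness passes to open subgroupoids, since open bisections of
    the subgroupoid are open bisections of the whole ([topologically_free_sub]).

    If the condition on points fails for [u] and [f_1, ..., f_n], then the
    germs of [u] over the basic open set [v C \ (f_1 \/ ... \/ f_n)], which
    contains [chi_v], form an open bisection without units; [u] fixes every
    principal character of that set and hence, by density, every character
    ([point_condition_of_topologically_free]).

    Conversely, an open bisection without units whose isotropy has interior
    contains, by density, an isotropic germ [[s, chi_x]], and the germs [[s,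
    chi]] are isotropic and belong to the bisection for [chi] near [chi_x].
    Then [s x = x u] with [u] invertible, so that [s (x z) = x (u z)]; pulling
    the basic neighbourhood of [chi_x] back along [x] gives data to which the
    condition on points applies.  It yields [z] with [u z = z], that is
    [s (x z) = x z], and therefore a unit [[s, chi_(x z)]] in the bisection
    ([topologically_free_of_point_condition]). *)

Set Implicit Arguments.
Unset Strict Implicit.
Unset Printing Implicit Defensive.

Local Open Scope classical_set_scope.

(** * Topological freeness of open subgroupoids *)

Lemma topologically_free_sub (G : etale_groupoid) (H : set G)
    (H_open : open H) (H_unit : forall x, H (gunit x))
    (H_mul : forall g h, gsrc g = grng h -> H g -> H h -> H (gmul g h))
    (H_inv : forall g, H g -> H (ginv g)) :
  topologically_free G ->
  topologically_free (open_subgroupoid H_open H_unit H_mul H_inv).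
Proof.
move=> free gamma [ogamma src_inj rng_inj] nonunit.
have lift (g h : H) : gamma g -> gamma h ->
    (gsrc (val g) = gsrc (val h) \/ grng (val g) = grng (val h)) -> g = h.
  by move=> gg gh [E|E]; [apply: src_inj|apply: rng_inj] => //; exact: mem_set.
have := free (val @` gamma).
have -> : [set x | isotropy x `&` (val @` gamma) !=set0] =
    [set x | @isotropy (open_subgroupoid H_open H_unit H_mul H_inv) x
               `&` gamma !=set0].
  apply/seteqP; split=> x.
    by move=> [k [[sx rx] [g gg gk]]]; subst k; exists g.
  by move=> [g [[sx rx] gg]]; exists (val g); split=> //; exists g.
apply.
- split.
  + have [W oW Wgamma] := ogamma.
    have -> : val @` gamma = W `&` H.
      rewrite -Wgamma; apply/seteqP; split=> g.
        by move=> [h Wh <-]; split=> //; exact: sub_arrP.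
      by move=> [Wg Hg]; exists (sub_arr Hg).
    exact: openI.
  + move=> k l /set_mem[g gg gk] /set_mem[h gh hl]; subst k l => E.
    by rewrite (lift g h) //; left.
  + move=> k l /set_mem[g gg gk] /set_mem[h gh hl]; subst k l => E.
    by rewrite (lift g h) //; right.
- move=> k [g gg gk]; subst k => -[x _ xg]; apply: (nonunit g gg); exists x => //.
  exact: val_inj.
Qed.

(** * Partial bijections and right translations *)

Section Translations.
Variable C : lc_category.
Implicit Types (c u v x y z : C).

(** Members of the left inverse hull commute with right translations. *)
Lemma inv_hull_cmp (s : set (C * C)) x y : inv_hull s -> s (x, y) ->
  dm x = dm y /\ forall z, tg z = dm x -> s (cmp x z, cmp y z).
Proof.
move=> hs; elim: hs x y => {s} [c|s t _ IHs _ IHt|s _ IHs] x y.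
- move=> /lmulE[tx ->]; split; first by rewrite dm_cmp.
  by move=> z tz; apply/lmulE; rewrite tg_cmp // cmpA.
- move=> [w /= /IHt[xw Et] /IHs[wy Es]]; split; first by rewrite xw.
  by move=> z tz; exists (cmp w z) => /=; [exact: Et|apply: Es; rewrite -xw].
- by move=> /IHs[yx E]; split=> // z tz; apply: E; rewrite yx.
Qed.

Lemma constructible_cmp (e : J C) x z :
  jset e x -> tg z = dm x -> jset e (cmp x z).
Proof.
have [s hs es] := jsetP e; rewrite es => -[y sxy] tz.
by exists (cmp y z); exact: (inv_hull_cmp hs sxy).2.
Qed.

Lemma tg_object v : objects v -> tg v = v.
Proof. by move=> dv; rewrite -{1}dv tg_dm dv. Qed.

(** $x\mathfrak C$ as a constructible ideal: it is the image of left
    multiplication by $x$, i.e. the domain of its inverse. *)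
Definition jrideal x : J C := jdom (il_inv (il_lmul x)).

Lemma jridealP x y : jset (jrideal x) y <-> exists2 z, tg z = dm x & y = cmp x z.
Proof.
split=> [[z /lmulE[tz yE]]|[z tz yE]]; first by exists z.
by exists z; apply/lmulE.
Qed.

Lemma jrideal_id x : jset (jrideal x) x.
Proof. by apply/jridealP; exists (dm x); rewrite ?tg_dm ?cmp_dm. Qed.

(** * Principal characters *)

Lemma principal_subproof x : Omega C (fun e : J C => `[< jset e x >]).
Proof.
split.
  split.
  - by exists (jrideal x); apply/asboolP; exact: jrideal_id.
  - by move=> e f; exact: asbool_and.
  - by move=> e e0; apply/asboolP; rewrite e0.
move=> e n f ef /asboolP; rewrite ef => -[i _ fi].
by exists i; apply/asboolP.
Qed.

(** The principal character $\chi_x$, with $\chi_x(e)=1$ iff $x\in e$. *)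
Definition principal x : Omega C :=
  exist _ (fun e : J C => `[< jset e x >]) (mem_set (principal_subproof x)).

Lemma chr_principal x (e : J C) : chr (principal x) e = `[< jset e x >].
Proof. by []. Qed.

Lemma principal_at x (e : J C) : jset e x -> Omega_at e (principal x).
Proof. by move=> ex; apply/asboolP. Qed.

Lemma principal_mem x y : principal x = principal y ->
  forall e : J C, jset e x <-> jset e y.
Proof.
move=> E e; have : chr (principal x) e = chr (principal y) e by rewrite E.
by rewrite !chr_principal; exact: asbool_eq_equiv.
Qed.

Lemma act_principal (s : Il C) x y (H : Omega_at (jdom s) (principal x)) :
  il s (x, y) -> act H = principal y.
Proof.
move=> sxy; apply: chr_inj; apply: funext => e.
rewrite chr_act !chr_principal; apply: asbool_equiv_eq.
split=> [[y' sxy' ey']|ey]; last by exists y.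
by have [sf _] := inv_hull_bij (ilP s); rewrite (sf _ _ _ sxy sxy').
Qed.

Lemma principal_eqP x y :
  principal x = principal y <-> ltrans x (@invertibles C) y.
Proof.
split=> [E|[w [[w' [dw dw' ww' w'w]] tw ->]]].
  have /(principal_mem E) /jridealP[w tw yE] := jrideal_id x.
  have /(principal_mem E) /jridealP[w' tw' xE] := jrideal_id y.
  (* [w] and [w'] are mutually inverse since [y = x w] and [x = y w'] *)
  have dw : dm w = tg w' by rewrite tw' yE dm_cmp.
  have dw' : dm w' = tg w by rewrite tw xE dm_cmp.
  exists w; split=> //; exists w'; split=> //.
  - apply: (@lc_cancel C x); rewrite ?tg_cmp ?tg_tg //.
    by rewrite cmpA // -yE -xE tw cmp_dm.
  - apply: (@lc_cancel C y); rewrite ?tg_cmp ?tg_dm //.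
      by rewrite yE dm_cmp.
    rewrite cmpA // -xE -yE.
    have -> : dm w = dm y by rewrite yE dm_cmp.
    by rewrite cmp_dm.
apply: chr_inj; apply: funext => e; rewrite !chr_principal.
apply: asbool_equiv_eq; split=> ex; first exact: constructible_cmp.
have : jset e (cmp (cmp x w) w') by apply: constructible_cmp; rewrite ?dm_cmp.
by rewrite -cmpA // ww' tw cmp_dm.
Qed.

(** * The topology of $\Omega$ *)

(** The conditions $\chi(e)=1$ and $\chi(f)=0$ for $f$ in the finite list
    [fs]; the characters that satisfy them form a basic open set. *)
Definition basic (e : J C) (fs : seq (J C)) (chi : Omega C) : bool :=
  chr chi e && all (fun f => ~~ chr chi f) fs.

(** Density of the principal characters.  If no point satisfied the
    conditions, then [e] would be the union of its intersections with the [fs],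
    and the defining property of $\Omega$ would give [chi f] for some [f]. *)
Lemma basic_open_point e fs chi : basic e fs chi ->
  exists2 x, jset e x & forall f, f \in fs -> ~ jset f x.
Proof.
move=> /andP[ce /allP cf]; apply: contrapT => none.
have [] := (chrP chi).2 e (size fs) (fun i => jcap e (nth e fs i)).
- apply/seteqP; split=> [x ex|x [i _ []] //].
  apply: contrapT => nx; apply: none; exists x => // f ffs fx; apply: nx.
  have ltf : (index f fs < size fs)%N by rewrite index_mem.
  by exists (Ordinal ltf) => //; split=> //=; rewrite nth_index.
- exact: ce.
- move=> i ci; have : chr chi (jcap e (nth e fs i)) by [].
  rewrite chrI => /andP[_].
  by apply/negP/cf/mem_nth.
Qed.

Lemma basic_principal e fs x : basic e fs (principal x) <->
  jset e x /\ forall f, f \in fs -> ~ jset f x.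
Proof.
split=> [/andP[/asboolP ex /allP nf]|[ex nf]].
  by split=> // f /nf /asboolPn.
apply/andP; split; first exact/asboolP.
by apply/allP => f /nf nfx; apply/asboolPn.
Qed.

Lemma chr_open (e : J C) (b : bool) : open [set chi : Omega C | chr chi e = b].
Proof.
have -> : [set chi : Omega C | chr chi e = b] =
    set_val @^-1` (proj e @^-1` [set b] : set {ptws J C -> bool}).
  by apply/seteqP; split.
apply: open_comp; first by move=> + _; exact: initial_continuous.
apply: open_comp; first by move=> + _; exact: proj_continuous.
exact: discrete_open.
Qed.

Lemma basic_open e fs : open [set chi | basic e fs chi].
Proof.
elim: fs => [|f fs IH].
  have -> : [set chi | basic e [::] chi] = [set chi | chr chi e = true].
    by apply/seteqP; split=> chi /=; rewrite /basic /= andbT.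
  exact: chr_open.
have -> : [set chi | basic e (f :: fs) chi] =
    [set chi | chr chi f = false] `&` [set chi | basic e fs chi].
  apply/seteqP; split=> chi; rewrite /basic /= andbCA.
    by move=> /andP[/negbTE].
  by move=> [-> ->].
by apply: openI => //; exact: chr_open.
Qed.

(** Basic open sets form a base of the topology of $\Omega$. *)
Lemma open_basic (U : set (Omega C)) chi : open U -> U chi ->
  exists e fs, basic e fs chi /\ forall psi, basic e fs psi -> U psi.
Proof.
move=> [V oV VU] Uchi.
(* the sets of functions whose trace on [Omega] contains a basic open
   neighbourhood of [chi] form a filter that converges to [chi] *)
pose F : set_system {ptws J C -> bool} := [set A | exists e fs,
  basic e fs chi /\ forall psi, basic e fs psi -> A (val psi)].
have FF : Filter F.
  split.
  - by have [e ce] := chr_ex chi; exists e, [::]; rewrite /basic ce.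
  - move=> A B [e [fs [cA A_]]] [e' [fs' [cB B_]]].
    exists (jcap e e'), (fs ++ fs').
    have E psi : basic (jcap e e') (fs ++ fs') psi =
        basic e fs psi && basic e' fs' psi.
      by rewrite /basic chrI all_cat andbACA.
    rewrite E cA; split=> // psi; rewrite E => /andP[pA pB].
    by split; [exact: A_|exact: B_].
  - move=> A B AB [e [fs [cA A_]]]; exists e, fs; split=> // psi /A_.
    exact: AB.
have Fchi : F --> (val chi : {ptws J C -> bool}).
  apply/cvg_sup => e A [_ [[B oB <-] Bchi] BA].
  have [k ck] := chr_ex chi.
  case ce : (chr chi e).
    exists e, [::]; rewrite /basic ce; split=> // psi /andP[pe _]; apply: BA.
    by move: Bchi; rewrite /= -/(chr chi e) -/(chr psi e) ce pe.
  exists k, [:: e]; rewrite /basic ck /= ce; split=> // psi.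
  rewrite andbT => /andP[_ /negbTE pe]; apply: BA.
  by move: Bchi; rewrite /= -/(chr chi e) -/(chr psi e) ce pe.
have nV : nbhs (val chi : {ptws J C -> bool}) V.
  by apply: open_nbhs_nbhs; split=> //; rewrite -VU in Uchi.
have [e [fs [ce Ve]]] := Fchi V nV.
by exists e, fs; split=> // psi /Ve; rewrite -VU.
Qed.

(** * Units and isotropy on principal characters *)

(** A germ is a unit exactly when the partial bijection is the identity on a
    constructible ideal in its character. *)
Lemma germ_unitP (s : Il C) chi (H : Omega_at (jdom s) chi) :
  range (@germ_unit C) (mk_germ H) <->
  exists2 e, chr chi e & forall x, jset e x -> il s (x, x).
Proof.
split=> [[psi _]|[e ce sid]].
  have [e ce] := chr_ex psi; rewrite (germ_unitE (id_dom ce)).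
  move=> /mk_germ_inj[<- [f cf E]]; exists (jcap e f); first by rewrite chrI ce.
  by move=> x [ex fx]; apply/E.
have [sf _] := inv_hull_bij (ilP s).
exists chi => //; rewrite (germ_unitE (id_dom ce)).
apply: (@mk_germ_eq _ _ _ _ _ _ _ e) => // x y ex; split=> [[_ /= ->]|sxy]; first exact: sid.
by split=> //=; rewrite (sf _ _ _ sxy (sid x ex)).
Qed.

Lemma principal_unit (s : Il C) x (H : Omega_at (jdom s) (principal x)) :
  il s (x, x) -> range (@germ_unit C) (mk_germ H).
Proof.
move=> sxx; apply/germ_unitP; exists (jrideal x).
  exact/principal_at/jrideal_id.
by move=> y /jridealP[z tz ->]; exact: (inv_hull_cmp (ilP s) sxx).2.
Qed.

Lemma act_inj (s : Il C) chi psi (H : Omega_at (jdom s) chi)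
  (K : Omega_at (jdom s) psi) : act H = act K -> chi = psi.
Proof.
move=> E; have HI := act_inv_dom H; have KI := act_inv_dom K.
rewrite -(act_inv HI) -(act_inv KI).
by apply: chr_inj; apply: funext => e; rewrite (chr_act HI) (chr_act KI) E.
Qed.

(** * Topological freeness in terms of points *)

(** If $u$ maps every $z\in\mathfrak v\mathfrak C$ outside the ideals $f_i$ into
    $z\mathfrak C^*$, then $u$ fixes one of these points. *)
Definition point_condition : Prop :=
  forall v u : C, objects v -> invertibles_at v u ->
  forall (n : nat) (f : 'I_n -> J C), (forall i, f i `<` rideal v) ->
    (forall z, (rideal v `\` \bigcup_i f i) z ->
       ltrans z (@invertibles C) (cmp u z)) ->
    exists2 x, (rideal v `\` \bigcup_i f i) x & cmp u x = x.

Lemma point_condition_of_topologically_free :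
  topologically_free (invertible_groupoid C) -> point_condition.
Proof.
move=> free v u ov [iu tu du] n f fv uC; apply: contrapT => nofix.
have tv := tg_object ov.
pose s := il_lmul u; pose fs := codom f.
have domE x : jset (jdom s) x <-> tg x = v.
  split=> [[y /lmulE[-> _]] //|tx].
  by exists (cmp u x); apply/lmulE; rewrite tx.
have outside x : jset (jdom s) x -> (forall k, k \in fs -> ~ jset k x) ->
    (rideal v `\` \bigcup_i f i) x.
  move=> /domE tx nf; split; first by rewrite ridealE.
  by move=> [i _ fi]; exact: (nf _ (codom_f f i) fi).
(* outside the ideals [f i], the points [x] and [u x] lie in the same
   constructible ideals, as [u x] belongs to [x C^*] *)
have fixes x : jset (jdom s) x -> (forall k, k \in fs -> ~ jset k x) ->
    forall e : J C, jset e x <-> jset (jpre s e) x.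
  move=> dx nf e; have /principal_eqP E := uC x (outside x dx nf).
  apply: (iff_trans (principal_mem E e)); split=> [eux|[y /lmulE[_ ->] //]]; exists (cmp u x) => //; apply/lmulE.
  by rewrite du; split=> //; exact/domE.
pose U : set (Omega C) := [set chi | basic (jdom s) fs chi].
have actU chi (H : Omega_at (jdom s) chi) : U chi -> act H = chi.
  move=> /andP[ds nfs]; apply: chr_inj; apply: funext => e; rewrite chr_act.
  (* if [e] separates [u.chi] from [chi], then by density it separates [u x]
     from [x] for some point [x] of [U] *)
  case cp : (chr chi (jpre s e)); case ce : (chr chi e) => //.
    have : basic (jcap (jdom s) (jpre s e)) (e :: fs) chi.
      by rewrite /basic chrI ds cp /= ce.
    move=> /basic_open_point[x [dx px] nx]; exfalso.
    apply: (nx e); first by rewrite inE eqxx.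
    apply: (fixes x dx _ e).2 px => k kfs.
    by apply: nx; rewrite inE kfs orbT.
  have : basic (jcap (jdom s) e) (jpre s e :: fs) chi.
    by rewrite /basic chrI ds ce /= cp.
  move=> /basic_open_point[x [dx ex] nx]; exfalso.
  apply: (nx (jpre s e)); first by rewrite inE eqxx.
  apply: (fixes x dx _ e).1 ex => k kfs.
  by apply: nx; rewrite inE kfs orbT.
pose gamma : set (invertible_groupoid C) := val @^-1` germ_slice s U.
have ogamma : open_bisection gamma.
  split.
  - by exists (germ_slice s U) => //; exact/germ_slice_open/basic_open.
  - move=> g h /set_mem[chi [H _ gE]] /set_mem[psi [K _ hE]] E.
    have : germ_src (val g) = germ_src (val h) := E.
    rewrite gE hE !germ_srcE => cp; apply: val_inj; rewrite gE hE.
    exact: mk_germ_irr.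
  - move=> g h /set_mem[chi [H _ gE]] /set_mem[psi [K _ hE]] E.
    have : germ_rng (val g) = germ_rng (val h) := E.
    rewrite gE hE !germ_rngE => /act_inj cp; apply: val_inj; rewrite gE hE.
    exact: mk_germ_irr.
have nonunit : gamma `<=` ~` range (@gunit (invertible_groupoid C)).
  move=> g [chi [H /andP[ds nfs] gE]] [psi _ psig].
  have : range (@germ_unit C) (mk_germ H) by exists psi => //; rewrite -gE -psig.
  move=> /germ_unitP[e ce sid].
  have : basic (jcap (jdom s) e) fs chi by rewrite /basic chrI ds ce.
  move=> /basic_open_point[x [dx ex] nx]; apply: nofix.
  exists x; first exact: outside.
  by have /lmulE[_ <-] := sid x ex.
have Uv : U (principal v).
  apply/basic_principal; split; first exact/domE.
  move=> _ /codomP[i ->] fiv; have [_] := fv i; apply=> z [w [_ tw ->]].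
  exact: constructible_cmp.
suff : U `<=` [set chi | isotropy chi `&` gamma !=set0].
  by rewrite open_subsetE ?(free gamma) //; [move=> /(_ _ Uv)|exact: basic_open].
move=> chi Uchi.
have H : Omega_at (jdom s) chi by case/andP: Uchi.
have iH : invertible_germs (mk_germ H).
  by exists u, chi; [exists H|split; rewrite // tu].
exists (sub_arr iH); split; last by exists chi, H.
split; [exact: germ_srcE|].
by rewrite -[RHS](actU chi H) //; exact: germ_rngE.
Qed.

Lemma topologically_free_of_point_condition :
  point_condition -> topologically_free (transformation_groupoid C).
Proof.
move=> pc gamma [ogamma src_inj _] nonunit.
apply/seteqP; split=> // chi0; set W := _° => Wchi0.
have oW : open W by exact: open_interior.
have [e1 [fs1 [/basic_open_point[x e1x nf1x] W1]]] := open_basic oW Wchi0.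
have Wx : W (principal x) by apply/W1/basic_principal.
have [g [[gs gr] gg]] := interior_subset Wx.
elim/germ_ind: g gs gr gg => s chi H.
rewrite /= germ_srcE germ_rngE => chix; subst chi => actH gH.
have oU : open (W `&` germ_trace s gamma) by exact: openI.
have [e [fs [/basic_principal[ex nfx] Usub]]] :
    exists e fs, basic e fs (principal x) /\
      forall psi, basic e fs psi -> (W `&` germ_trace s gamma) psi.
  by apply: open_basic => //; split=> //; exists H.
have [y sxy] : jset (jdom s) x by exact/asboolP/H.
have /principal_eqP[u [iu tu yE]] : principal x = principal y.
  by rewrite -(act_principal H sxy).
have [dxy scmp] := inv_hull_cmp (ilP s) sxy.
have du : dm u = dm x by rewrite dxy yE dm_cmp.
(* the ideals of all [z] with [x z] in the members of [fs]; they are proper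
   because they do not contain [dm x], as [x = x (dm x)] is in none of [fs] *)
pose f (i : 'I_(size fs)) := jpre (il_lmul x) (nth e fs i).
have fP i z : jset (f i) z <-> tg z = dm x /\ jset (nth e fs i) (cmp x z).
  split=> [[w /lmulE[tz ->]] //|[tz fz]].
  by exists (cmp x z) => //; apply/lmulE.
have rE : rideal (dm x) = [set z : C | tg z = dm x] by rewrite ridealE ?dm_dm.
have fprop i : f i `<` rideal (dm x).
  split=> [z /fP[tz _]|sub]; first by rewrite rE.
  have /sub /fP[_] : rideal (dm x) (dm x) by rewrite rE /= tg_dm.
  by rewrite cmp_dm; apply/nfx/mem_nth.
have near z : (rideal (dm x) `\` \bigcup_i f i) z ->
    tg z = dm x /\ (W `&` germ_trace s gamma) (principal (cmp x z)).
  rewrite rE => -[/= tz nz]; split=> //; apply/Usub/basic_principal.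
  split; first exact: constructible_cmp.
  move=> k kfs kxz; apply: nz.
  have ltk : (index k fs < size fs)%N by rewrite index_mem.
  by exists (Ordinal ltk) => //; apply/fP; rewrite /= nth_index.
have ov : objects (dm x) by exact: dm_dm.
have [||z /near[tz [_ [K gK]]] uz] := pc (dm x) u ov _ _ f fprop.
- by [].
- move=> z /near[tz [/interior_subset[h [[hs hr] gh]] [K gK]]].
  (* the isotropic germ of [gamma] at [chi_(x z)] has the same source as the
     germ of [s], hence is equal to it *)
  have hK : h = mk_germ K.
    by apply: src_inj; rewrite ?inE //= germ_srcE.
  have /principal_eqP[w [iw tw]] :
      principal (cmp x z) = principal (cmp y z).
    rewrite -(act_principal K (scmp z tz)) -germ_rngE -hK.
    exact/esym/hr.
  rewrite yE -cmpA ?du // -(cmpA (d := z)) ?tz //; last first.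
    by rewrite tw dm_cmp.
  (* [x (u z) = x (z w)], where [x] can be cancelled *)
  move=> E; exists w; split=> //; first by rewrite tw dm_cmp.
  apply: (@lc_cancel C x) E.
    by rewrite tg_cmp ?du.
  by rewrite tg_cmp ?tz // tw dm_cmp.
- apply: (nonunit _ gK); apply: principal_unit.
  by have := scmp z tz; rewrite yE -cmpA ?du // uz.
Qed.

End Translations.

Theorem theorem4p4 (C : lc_category) :
  (topologically_free (transformation_groupoid C) <->
   topologically_free (invertible_groupoid C)) /\
  (topologically_free (invertible_groupoid C) <->
   forall v u : C, objects v -> invertibles_at v u ->
   forall (n : nat) (f : 'I_n -> J C), (forall i, f i `<` rideal v) ->
     (forall z, (rideal v `\` \bigcup_i f i) z ->
        ltrans z (@invertibles C) (cmp u z)) ->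
     exists2 x, (rideal v `\` \bigcup_i f i) x & cmp u x = x).
Proof.
have i_ii := @topologically_free_sub (transformation_groupoid C) _
  (@invertible_germs_open C) (@invertible_germs_unit C)
  (@invertible_germs_mul C) (@invertible_germs_inv C).
have ii_iii := @point_condition_of_topologically_free C.
have iii_i := @topologically_free_of_point_condition C.
split; split.
- exact: i_ii.
- by move=> /ii_iii /iii_i.
- exact: ii_iii.
- by move=> /iii_i /i_ii.
Qed.
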